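(* Let $(M^m,g,J)$ be a compact connected Kähler manifold of complex dimension $m$ and diameter $D$ (without boundary, or with a smooth strictly convex boundary) whose holomorphic sectional curvature is bounded from below by $4\kappa_1$ and whose orthogonal Ricci curvature is bounded from below by $2(m-1)\kappa_2$, for some $\kappa_1,\kappa_2\in\mathbb{R}$. Let $\bar\mu_1(m,\kappa_1,\kappa_2,D)$ be the first nonzero Neumann eigenvalue of the one-dimensional eigenvalue problem $$\varphi''-\left(2(m-1)T_{\kappa_2}+T_{4\kappa_1}\right)\varphi'=-\lambda\varphi\quad\text{on }[-D/2,D/2].$$ Then $$\bar\mu_1(m,\kappa_1,\kappa_2,D)\ \begin{cases}=\dfrac{\pi^2}{D^2},&\text{if }\kappa_1=\kappa_2=0;\\[2mm] \geq\bar\mu_1\!\left(m,\kappa_1,0,\dfrac{\pi}{2\sqrt{\kappa_1}}\right)=8\kappa_1,&\text{if }\kappa_1>0,\ \kappa_2=0;\\[2mm] \geq\bar\mu_1\!\left(m,0,\kappa_2,\dfrac{\pi}{\sqrt{\kappa_2}}\right)=(2m-1)\kappa_2,&\text{if }\kappa_1=0,\ \kappa_2>0.\end{cases}$$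
   Context: Curvatures: $M$ is regarded as a Riemannian manifold of real dimension $2m$ with parallel complex structure $J$. The holomorphic sectional curvature is $H(X)=R(X,JX,X,JX)/|X|^4$ for $X\neq0$, i.e. the sectional curvature of the plane spanned by $X$ and $JX$. It is bounded from below by $\kappa$ if $H(X)\ge\kappa$ for all nonzero tangent $X$. The orthogonal Ricci curvature is $\mathrm{Ric}^\perp(X,X)=\mathrm{Ric}(X,X)-H(X)|X|^2$. It is bounded from below by $\kappa$ if $\mathrm{Ric}^\perp(X,X)\ge\kappa|X|^2$ for all tangent $X$. The function $T_\kappa$: for $\kappa\in\mathbb{R}$, $T_\kappa(t)=\sqrt{\kappa}\tan(\sqrt{\kappa}\,t)$ if $\kappa>0$, $T_0(t)=0$, and $T_\kappa(t)=-\sqrt{-\kappa}\tanh(\sqrt{-\kappa}\,t)$ if $\kappa<0$. Model problem: it is considered when $T_{\kappa_2}$ and $T_{4\kappa_1}$ are finite on $(-D/2,D/2)$. If the coefficient is singular at the endpoints, the first nonzero Neumann eigenvalue is understood variationally, as the infimum of $\int_{-D/2}^{D/2}|\phi'|^2w\,ds\big/\int_{-D/2}^{D/2}|\phi|^2w\,ds$ over nonzero $\phi$ with $\int_{-D/2}^{D/2}\phi\,w\,ds=0$. Here $w=c_{\kappa_2}^{2m-2}c_{4\kappa_1}$, with $c_\kappa(t)=\cos(\sqrt{\kappa}t)$, $1$, $\cosh(\sqrt{-\kappa}t)$ for $\kappa>0$, $\kappa=0$, $\kappa<0$ respectively. The same definition applies with $D$ replaced by $\pi/(2\sqrt{\kappa_1})$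 or $\pi/\sqrt{\kappa_2}$. *)

(* Defs.v *)
From HB Require Import structures.
From mathcomp Require Import all_boot all_order all_algebra.
From mathcomp Require Import all_classical all_reals all_analysis.
Set Implicit Arguments.
Unset Strict Implicit.
Unset Printing Implicit Defensive.
Import Order.TTheory GRing.Theory Num.Theory.
Import numFieldNormedType.Exports.
Local Open Scope classical_set_scope.
Local Open Scope ring_scope.

(** * Tensor calculus in coordinates

  Points of a coordinate domain and components of tangent vectors are column
  vectors.  A metric is a matrix field [g] with [g x i j = g_ij(x)]; an
  endomorphism field [A] acts on components by [X |-> A x *m X]. *)

Definition pd (R : realType) (n : nat) (i : 'I_n) (f : 'cV[R]_n -> R)
    (x : 'cV[R]_n) : R :=
  'D_(delta_mx i ord0) f x.

Definition iter_pd (R : realType) (n : nat) (s : seq 'I_n)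
    (f : 'cV[R]_n -> R) : 'cV[R]_n -> R :=
  foldr (fun i h => pd i h) f s.

Definition smooth_on (R : realType) (n : nat) (U : set 'cV[R]_n)
    (f : 'cV[R]_n -> R) : Prop :=
  forall (s : seq 'I_n) (x : 'cV[R]_n), U x ->
    {for x, continuous (iter_pd s f)} /\
    (forall i : 'I_n, derivable (iter_pd s f) x (delta_mx i ord0)).

Definition jacobian_mx (R : realType) (n : nat) (F : 'cV[R]_n -> 'cV[R]_n)
    (x : 'cV[R]_n) : 'M[R]_n :=
  \matrix_(a, i) pd i (fun y => F y a ord0) x.

Definition inner (R : realType) (n : nat) (g : 'M[R]_n) (X Y : 'cV[R]_n) : R :=
  (X^T *m g *m Y) ord0 ord0.

Definition riem_norm (R : realType) (n : nat) (g : 'M[R]_n) (X : 'cV[R]_n) : R :=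
  Num.sqrt (inner g X X).

(** [christoffel g k i j x] is [Gamma^k_ij(x)] of the Levi-Civita connection. *)
Definition christoffel (R : realType) (n : nat) (g : 'cV[R]_n -> 'M[R]_n)
    (k i j : 'I_n) (x : 'cV[R]_n) : R :=
  2^-1 * \sum_(l < n) invmx (g x) k l *
    (pd i (fun y => g y j l) x + pd j (fun y => g y i l) x
     - pd l (fun y => g y i j) x).

(** [R(d_i, d_j) d_k = \sum_l riemann g l i j k . d_l], where
    [R(X, Y) = [nabla_X, nabla_Y] - nabla_[X, Y]]. *)
Definition riemann (R : realType) (n : nat) (g : 'cV[R]_n -> 'M[R]_n)
    (l i j k : 'I_n) (x : 'cV[R]_n) : R :=
  pd i (christoffel g l j k) x - pd j (christoffel g l i k) x
  + \sum_(p < n) (christoffel g l i p x * christoffel g p j k x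
                  - christoffel g l j p x * christoffel g p i k x).

(** [R(X, Y, Z, W) = g(R(X, Y) W, Z)], so that [R(X, Y, X, Y)] is the sectional
    curvature of an orthonormal pair (positive on round spheres). *)
Definition riemann4 (R : realType) (n : nat) (g : 'cV[R]_n -> 'M[R]_n)
    (x X Y Z W : 'cV[R]_n) : R :=
  inner (g x)
    (\col_l \sum_(i < n) \sum_(j < n) \sum_(k < n)
       riemann g l i j k x * X i ord0 * Y j ord0 * W k ord0) Z.

Definition ricci (R : realType) (n : nat) (g : 'cV[R]_n -> 'M[R]_n)
    (x X Y : 'cV[R]_n) : R :=
  \sum_(j < n) \sum_(k < n)
    (\sum_(i < n) riemann g i i j k x) * X j ord0 * Y k ord0.

Definition hol_sect_curv (R : realType) (n : nat) (g J : 'cV[R]_n -> 'M[R]_n)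
    (x X : 'cV[R]_n) : R :=
  riemann4 g x X (J x *m X) X (J x *m X) / riem_norm (g x) X ^+ 4.

Definition orth_ricci (R : realType) (n : nat) (g J : 'cV[R]_n -> 'M[R]_n)
    (x X : 'cV[R]_n) : R :=
  ricci g x X X - hol_sect_curv g J x X * riem_norm (g x) X ^+ 2.

(** Component [(nabla_k J)^i_j]. *)
Definition cov_deriv_endo (R : realType) (n : nat) (g J : 'cV[R]_n -> 'M[R]_n)
    (k i j : 'I_n) (x : 'cV[R]_n) : R :=
  pd k (fun y => J y i j) x
  + \sum_(l < n) (christoffel g i k l x * J x l j
                  - christoffel g l k j x * J x i l).

(** * Kaehler manifolds with (possibly empty) smooth boundary *)

(** Closed half-space [{x | 0 <= x_0}]. *)
Definition half_space (R : realType) (n : nat) : set 'cV[R]_n :=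
  [set x | forall i : 'I_n, i = 0%N :> nat -> 0 <= x i ord0].
Arguments half_space : clear implicits.

(** A chart [c] is a homeomorphism [coord c] from the open set [dom c] onto
    [rng c `&` half_space], with inverse [par c].  The local expressions of the
    metric and of the complex structure are smooth on the whole open set
    [rng c]: on a manifold with boundary this is the usual meaning of smoothness
    up to the boundary (existence of a smooth extension).  Only their values on
    [rng c `&` half_space] are geometric; these determine all the derivatives
    there. *)
Record kahler_manifold (R : realType) (m : nat) (M : topologicalType) := Kahler {
  chart : Type;
  dom : chart -> set M;
  rng : chart -> set 'cV[R]_(2 * m);
  coord : chart -> M -> 'cV[R]_(2 * m);
  par : chart -> 'cV[R]_(2 * m) -> M;
  metric : chart -> 'cV[R]_(2 * m) -> 'M[R]_(2 * m);
  cplx : chart -> 'cV[R]_(2 * m) -> 'M[R]_(2 * m);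

  kahler_hausdorff : hausdorff_space M;
  dom_cover : forall p, exists c, dom c p;
  dom_open : forall c, open (dom c);
  rng_open : forall c, open (rng c);
  coord_in : forall c p, dom c p -> (rng c `&` half_space R (2 * m)) (coord c p);
  par_in : forall c x, (rng c `&` half_space R (2 * m)) x -> dom c (par c x);
  coordK : forall c p, dom c p -> par c (coord c p) = p;
  parK : forall c x, (rng c `&` half_space R (2 * m)) x -> coord c (par c x) = x;
  coord_continuous : forall c, {within dom c, continuous (coord c)};
  par_continuous :
    forall c, {within rng c `&` half_space R (2 * m), continuous (par c)};

  metric_smooth : forall c i j, smooth_on (rng c) (fun x => metric c x i j);
  cplx_smooth : forall c i j, smooth_on (rng c) (fun x => cplx c x i j);

  (* changes of coordinates are smooth and transform the two tensor fields *)
  transition : forall c d p, dom c p -> dom d p ->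
    exists F : 'cV[R]_(2 * m) -> 'cV[R]_(2 * m),
    [/\ exists U, [/\ open U, U (coord c p) &
          forall a, smooth_on U (fun x => F x a ord0)],
        (\forall q \near p, coord d q = F (coord c q)),
        metric c (coord c p) =
          (jacobian_mx F (coord c p))^T *m metric d (coord d p)
            *m jacobian_mx F (coord c p) &
        cplx d (coord d p) *m jacobian_mx F (coord c p) =
          jacobian_mx F (coord c p) *m cplx c (coord c p)];

  metric_sym : forall c x, (rng c `&` half_space R (2 * m)) x ->
    (metric c x)^T = metric c x;
  metric_pos : forall c x, (rng c `&` half_space R (2 * m)) x ->
    forall X : 'cV[R]_(2 * m), X != 0 -> 0 < inner (metric c x) X X;
  cplx_sqr : forall c x, (rng c `&` half_space R (2 * m)) x ->
    cplx c x *m cplx c x = - 1%:M;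
  metric_hermitian : forall c x, (rng c `&` half_space R (2 * m)) x ->
    forall X Y : 'cV[R]_(2 * m), inner (metric c x) (cplx c x *m X) (cplx c x *m Y)
                = inner (metric c x) X Y;
  cplx_parallel : forall c x, (rng c `&` half_space R (2 * m)) x ->
    forall k i j, cov_deriv_endo (metric c) (cplx c) k i j x = 0
}.

Definition hol_sect_curv_ge (R : realType) (m : nat) (M : topologicalType)
    (K : kahler_manifold R m M) (k : R) : Prop :=
  forall (c : chart K) (p : M), dom c p -> forall X : 'cV[R]_(2 * m), X != 0 ->
    k <= hol_sect_curv (metric c) (cplx c) (coord c p) X.

Definition orth_ricci_ge (R : realType) (m : nat) (M : topologicalType)
    (K : kahler_manifold R m M) (k : R) : Prop :=
  forall (c : chart K) (p : M), dom c p -> forall X : 'cV[R]_(2 * m),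
    k * riem_norm (metric c (coord c p)) X ^+ 2
      <= orth_ricci (metric c) (cplx c) (coord c p) X.

Definition manifold_boundary (R : realType) (m : nat) (M : topologicalType)
    (K : kahler_manifold R m M) : set M :=
  [set p | exists (c : chart K) (i : 'I_(2 * m)),
     [/\ i = 0%N :> nat, dom c p & coord c p i ord0 = 0]].

(** In a chart the boundary is [x_0 = 0] and the inward unit normal is
    [nu = grad x_0 / |grad x_0|], with [|grad x_0|^2 = g^00].  For [X] tangent to
    the boundary, extended with constant components,
    [g(nabla_X X, nu) = Gamma^0_ij X^i X^j / sqrt(g^00)].  The sign makes the unit
    sphere bounding the flat unit ball positive. *)
Definition second_fund_form (R : realType) (n : nat) (g : 'cV[R]_n -> 'M[R]_n)
    (i0 : 'I_n) (x X : 'cV[R]_n) : R :=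
  (\sum_(i < n) \sum_(j < n) christoffel g i0 i j x * X i ord0 * X j ord0)
  / Num.sqrt (invmx (g x) i0 i0).

Definition strictly_convex_boundary (R : realType) (m : nat)
    (M : topologicalType) (K : kahler_manifold R m M) : Prop :=
  forall (c : chart K) (p : M) (i0 : 'I_(2 * m)), i0 = 0%N :> nat ->
    dom c p -> coord c p i0 ord0 = 0 ->
    forall X : 'cV[R]_(2 * m), X != 0 -> X i0 ord0 = 0 ->
      0 < second_fund_form (metric c) i0 (coord c p) X.

(** The curves are parametrized by the whole line and joined on [[0, 1]]; as
    their velocity may vanish, piecewise C^1 paths on [[0, 1]] become such curves
    after reparametrization (stopping at corners and end points). *)
Definition C1_curve (R : realType) (m : nat) (M : topologicalType)
    (K : kahler_manifold R m M) (gam : R -> M) : Prop :=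
  continuous gam /\
  forall (t : R) (c : chart K), dom c (gam t) ->
    derivable (coord c \o gam) t 1 /\ {for t, continuous (derive1 (coord c \o gam))}.

Definition is_speed (R : realType) (m : nat) (M : topologicalType)
    (K : kahler_manifold R m M) (gam : R -> M) (s : R -> R) : Prop :=
  forall (t : R) (c : chart K), dom c (gam t) ->
    s t = riem_norm (metric c (coord c (gam t))) (derive1 (coord c \o gam) t).

Definition riem_dist (R : realType) (m : nat) (M : topologicalType)
    (K : kahler_manifold R m M) (p q : M) : \bar R :=
  ereal_inf [set l | exists (gam : R -> M) (s : R -> R),
    [/\ C1_curve K gam, gam 0 = p, gam 1 = q, is_speed K gam s &
        l = (\int[lebesgue_measure]_(t in `[0%R, 1%R]) (s t)%:E)%E]].

Definition diameter (R : realType) (m : nat) (M : topologicalType)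
    (K : kahler_manifold R m M) : \bar R :=
  ereal_sup [set l | exists p q : M, l = riem_dist K p q].

(** * The one-dimensional model problem *)

Definition tanh (R : realType) (t : R) : R :=
  (expR t - expR (- t)) / (expR t + expR (- t)).

Definition cosh (R : realType) (t : R) : R := (expR t + expR (- t)) / 2.

Definition ck (R : realType) (k t : R) : R :=
  if 0 < k then cos (Num.sqrt k * t)
  else if k == 0 then 1 else cosh (Num.sqrt (- k) * t).

Definition Tk (R : realType) (k t : R) : R :=
  if 0 < k then Num.sqrt k * tan (Num.sqrt k * t)
  else if k == 0 then 0 else - (Num.sqrt (- k) * tanh (Num.sqrt (- k) * t)).

(** [Tk k = - (ck k)' / ck k] has its poles exactly at the zeros of [ck k]
    (where the total function [tan] takes an irrelevant value). *)
Definition Tk_finite (R : realType) (k t : R) : Prop := ck k t != 0.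

Definition model_considered (R : realType) (k1 k2 D : R) : Prop :=
  forall t, t \in `](- (D / 2)), (D / 2)[ ->
    Tk_finite k2 t /\ Tk_finite (4 * k1) t.

Definition singular_endpoints (R : realType) (k1 k2 D : R) : Prop :=
  ~ (Tk_finite k2 (D / 2) /\ Tk_finite (4 * k1) (D / 2)).

Definition model_coef (R : realType) (m : nat) (k1 k2 t : R) : R :=
  2 * (m%:R - 1) * Tk k2 t + Tk (4 * k1) t.

Definition model_weight (R : realType) (m : nat) (k1 k2 t : R) : R :=
  ck k2 t ^+ (2 * m - 2) * ck (4 * k1) t.

(** For a coefficient continuous on the closed interval, a solution on the open
    interval is C^2 up to the endpoints, so the one-sided limits below are the
    Neumann conditions [phi'(-D/2) = phi'(D/2) = 0]. *)
Definition neumann_eigenvalue (R : realType) (m : nat) (k1 k2 D lam : R) : Prop :=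
  exists phi : R -> R,
  [/\ exists2 t, t \in `](- (D / 2)), (D / 2)[ & phi t != 0,
      forall t, t \in `](- (D / 2)), (D / 2)[ ->
        [/\ derivable phi t 1, derivable (derive1 phi) t 1 &
            derive1n 2 phi t - model_coef m k1 k2 t * derive1 phi t = - lam * phi t],
      derive1 phi t @[t --> (- (D / 2))^'+] --> (0 : R) &
      derive1 phi t @[t --> (D / 2)^'-] --> (0 : R)].

(** Weighted Sobolev space [H^1(w)]: [phi] is the locally absolutely continuous
    primitive of [dphi] in the open interval, and both are square integrable for
    the weight. *)
Definition weighted_H1 (R : realType) (D : R) (w phi dphi : R -> R) : Prop :=
  [/\ forall a b, - (D / 2) < a -> a <= b -> b < D / 2 ->
        lebesgue_measure.-integrable `[a, b] (EFin \o dphi) /\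
        phi b - phi a = \int[lebesgue_measure]_(t in `[a, b]) dphi t,
      lebesgue_measure.-integrable `](- (D / 2)), (D / 2)[
        (fun t => (phi t ^+ 2 * w t)%:E) &
      lebesgue_measure.-integrable `](- (D / 2)), (D / 2)[
        (fun t => (dphi t ^+ 2 * w t)%:E)].

Definition rayleigh_quotient (R : realType) (D : R) (w phi dphi : R -> R) : R :=
  (\int[lebesgue_measure]_(t in `](- (D / 2)), (D / 2)[) (dphi t ^+ 2 * w t))
  / (\int[lebesgue_measure]_(t in `](- (D / 2)), (D / 2)[) (phi t ^+ 2 * w t)).

Definition rayleigh_values (R : realType) (D : R) (w : R -> R) : set R :=
  [set q | exists phi dphi : R -> R,
     [/\ weighted_H1 D w phi dphi,
         exists2 t, t \in `](- (D / 2)), (D / 2)[ & phi t != 0,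
         \int[lebesgue_measure]_(t in `](- (D / 2)), (D / 2)[)
           (phi t * w t) = 0 &
         q = rayleigh_quotient D w phi dphi]].

(** First nonzero Neumann eigenvalue.  In the regular case the spectrum is an
    unbounded discrete subset of [[0, +oo[], so that the infimum is a minimum. *)
Definition mu1 (R : realType) (m : nat) (k1 k2 D : R) : \bar R :=
  if `[< singular_endpoints k1 k2 D >] then
    ereal_inf (EFin @` rayleigh_values D (model_weight m k1 k2))
  else
    ereal_inf (EFin @` [set lam | lam != 0 /\ neumann_eigenvalue m k1 k2 D lam]).

(* Main.v *)
(** The model weight is [w = cos(a t)^n], with [n = 1] when [kappa2 = 0] and
  [n = 2 m - 2] when [kappa1 = 0]; the extremal function is [sin(a t)], with
  eigenvalue [Lam = (n + 1) a^2].

  Regular endpoints: if [phi] is an eigenfunction, [h = phi' / cos(a t)] vanishes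
  at both ends and satisfies [(p h')' = (Lam - lam) p h] with
  [p = cos(a t)^(n + 2)].  If [lam < Lam], then [p h h'] is nondecreasing, so that
  [h^2], which tends to [0] at both ends, cannot be other than [0].

  Singular endpoints: by Cauchy-Schwarz with the weight [(sin(a t))' = a cos(a t)],
  [(phi t - phi 0)^2 <= |sin(a t)| int_0^t phi'^2 / (a cos)].  Integrating against
  [w], exchanging the integrals and using
  [int_x^d cos^n sin = cos^(n+1) x / ((n+1) a)] gives
  [int (phi - phi 0)^2 w <= int phi'^2 w / Lam], and the left-hand side is at least
  [int phi^2 w] when [phi] has weighted mean [0]. *)
Require Import Defs.
From mathcomp Require Import all_boot all_order all_algebra.
From mathcomp Require Import all_classical all_reals all_analysis.
From mathcomp Require Import measurable_realfun.
From mathcomp Require Import ring lra.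
Import Order.TTheory GRing.Theory Num.Theory.
Import numFieldNormedType.Exports.
Local Open Scope classical_set_scope.
Local Open Scope ring_scope.
Set Implicit Arguments.
Unset Strict Implicit.

(** * Derivative rules on the real line, and monotonicity from the sign of a derivative *)

Lemma is_derive_sinM (R : realType) (a x : R) :
  is_derive x 1 (fun t => sin (a * t)) (a * cos (a * x)).
Proof.
rewrite mulrC.
have h : is_derive x (1:R) (fun t => a * t : R) a.
  have := @is_deriveZ _ _ _ id a x 1 1 (is_derive_id _ _).
  by rewrite /GRing.scale/= mulr1.
exact: is_derive1_comp.
Qed.

Lemma is_derive_cosM (R : realType) (a x : R) :
  is_derive x 1 (fun t => cos (a * t)) (- (a * sin (a * x))).
Proof.
have h : is_derive x (1:R) (fun t => a * t : R) a.
  have := @is_deriveZ _ _ _ id a x 1 1 (is_derive_id _ _).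
  by rewrite /GRing.scale/= mulr1.
rewrite mulrC -mulNr.
exact: is_derive1_comp.
Qed.

Section real_is_derive.
Context {R : realType}.
Implicit Types (f g : R -> R) (x df dg : R).

Lemma is_deriveM_real f g x df dg :
  is_derive x (1 : R) f df -> is_derive x (1 : R) g dg ->
  is_derive x (1 : R) (fun t => f t * g t) (df * g x + f x * dg).
Proof.
move=> hf hg; have := is_deriveM hf hg.
by rewrite /GRing.scale/= addrC (mulrC (g x)).
Qed.

Lemma is_deriveX_real f x df n :
  is_derive x (1 : R) f df ->
  is_derive x (1 : R) (fun t => f t ^+ n) (n%:R * f x ^+ n.-1 * df).
Proof. by move=> /(is_deriveX n); rewrite /GRing.scale/= exprfctE. Qed.

Lemma is_derive_div_real f g x df dg : g x != 0 ->
  is_derive x (1 : R) f df -> is_derive x (1 : R) g dg ->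
  is_derive x (1 : R) (fun t => f t / g t) ((df * g x - f x * dg) / g x ^+ 2).
Proof.
move=> gx0 hf hg; have /= := is_deriveV gx0 hg.
move=> /(is_deriveM_real hf) /is_derive_eq; apply.
by rewrite /GRing.scale/=; field.
Qed.

Lemma is_derive_ge0_le f (df : R -> R) (a b : R) :
  (forall x, x \in `]a, b[ -> is_derive x (1 : R) f (df x)) ->
  (forall x, x \in `]a, b[ -> 0 <= df x) ->
  {in `]a, b[ &, {homo f : x y / x <= y}}.
Proof.
move=> fdf df0 u v uI vI uv; apply: (ger0_derive1_le_oo (a := a) (b := b)) => //.
- by move=> x /fdf [].
- by move=> x xab; have [_ e] := fdf _ xab; rewrite derive1E e df0.
- move=> x /set_mem /fdf [h _].
  by apply/differentiable_continuous/derivable1_diffP.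
Qed.

End real_is_derive.

Lemma cosM_gt0 {R : realType} (a d t : R) : 0 < a -> a * d <= pi / 2 ->
  t \in `](- d), d[ -> 0 < cos (a * t).
Proof.
move=> a0 ad; rewrite in_itv/= => /andP[t1 t2].
have h1 : a * t < a * d by rewrite ltr_pM2l.
have h2 : a * - d < a * t by rewrite ltr_pM2l.
by apply: cos_gt0_pihalf; apply/andP; split; nra.
Qed.

(** * Lower bound for nonzero Neumann eigenvalues, regular endpoints *)

Section neumann.
Context {R : realType} (n : nat) (a d lam : R) (phi : R -> R).
Hypotheses (a0 : 0 < a) (d0 : 0 < d) (ad : a * d < pi / 2) (lam0 : lam != 0).
Hypothesis phi_neq0 : exists2 t : R, t \in `](- d), d[ & phi t != 0.
Hypothesis phi_ode : forall t : R, t \in `](- d), d[ ->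
  [/\ derivable phi t 1, derivable (derive1 phi) t 1 &
      derive1n 2 phi t - n%:R * (a * tan (a * t)) * derive1 phi t
      = - lam * phi t].
Hypothesis phi_left : derive1 phi t @[t --> (- d)^'+] --> (0 : R).
Hypothesis phi_right : derive1 phi t @[t --> d^'-] --> (0 : R).

Local Notation I := `](- d), d[.
Let s t : R := sin (a * t).
Let c t : R := cos (a * t).
Let y : R -> R := derive1 phi.
(** With [h = y / c] and [p = c ^+ n.+2], [P] is [p h'] after the equation has been used to
    eliminate [phi'']; then [G] is [p h h'] and [k] is the square of [h]. *)
Let P t := c t ^+ n * (n.+1%:R * a * s t * y t - lam * (c t * phi t)).
Let G t := y t / c t * P t.
Let k t := (y t / c t) ^+ 2.

Let ds (t : R) : is_derive t 1 s (a * c t).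
Proof. exact: is_derive_sinM. Qed.

Let dc (t : R) : is_derive t 1 c (- (a * s t)).
Proof. exact: is_derive_cosM. Qed.

Let c_gt0 (t : R) : t \in I -> 0 < c t.
Proof. by apply: cosM_gt0 => //; exact: ltW. Qed.

Let dphi (t : R) : t \in I -> is_derive t 1 phi (y t).
Proof. by move=> /phi_ode[h _ _]; split => //; rewrite /y derive1E. Qed.

Let dy (t : R) : t \in I ->
  is_derive t 1 y (n%:R * a * s t / c t * y t - lam * phi t).
Proof.
move=> /phi_ode[_ h e]; split => //.
rewrite -derive1E -[LHS]/(derive1n 2 phi t).
move/eqP: e; rewrite subr_eq => /eqP ->.
by rewrite /tan -/(s t) -/(c t) -/(y t); ring.
Qed.

Let dyc (t : R) : t \in I -> is_derive t 1 (fun t => y t / c t) (P t / c t ^+ n.+2).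
Proof.
move=> tI; have c0 := lt0r_neq0 (c_gt0 tI).
have := is_derive_div_real c0 (dy tI) (dc t).
move/is_derive_eq; apply; rewrite /P -/(s t) -/(c t) -[n.+1%:R]natr1 !exprS.
have cn0 : c t ^+ n != 0 by rewrite expf_neq0.
move: (c t ^+ n) cn0 => Z Z0.
by field; exact/andP.
Qed.

Let dP (t : R) : t \in I ->
  is_derive t 1 P ((n.+1%:R * a ^+ 2 - lam) * c t ^+ n.+1 * y t).
Proof.
move=> tI; have c0 := lt0r_neq0 (c_gt0 tI).
have h1 : is_derive t 1 (fun t => c t ^+ n) (- (n%:R * a * s t / c t * c t ^+ n)).
  have := is_deriveX_real n (dc t).
  move/is_derive_eq; apply; rewrite -/(s t) -/(c t).
  (* The power rule produces the exponent [n.-1]; rewriting it as a division by [c t] is only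
     possible for positive [n], and for [n = 0] both sides vanish. *)
  case: n => [|j]; first by rewrite mulr0n !mul0r oppr0.
  by rewrite /= exprS; field; exact: c0.
have h2 := is_deriveM_real (ds t) (dy tI).
have h3 := is_deriveM_real (dc t) (dphi tI).
have h4 := is_deriveM_real (is_derive_cst (n.+1%:R * a) t (1:R)) h2.
have h5 := is_deriveM_real (is_derive_cst lam t (1:R)) h3.
have h6 := is_deriveM_real h1 (is_deriveB h4 h5).
have -> : P = (fun t => c t ^+ n * (n.+1%:R * a * (s t * y t) - lam * (c t * phi t))).
  by apply/funext => x; rewrite /P !mulrA.
move: h6; move/is_derive_eq; apply.
rewrite /= /cst -/(s t) -/(c t) -[n.+1%:R]natr1 !exprS.
rewrite -[LHS]/(- (n%:R * a * s t / c t * c t ^+ n) *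
  ((n%:R + 1) * a * (s t * y t) - lam * (c t * phi t)) + _).
by field; exact: c0.
Qed.

Let dG (t : R) : t \in I -> is_derive t 1 G
  (P t / c t ^+ n.+2 * P t
   + y t / c t * ((n.+1%:R * a ^+ 2 - lam) * c t ^+ n.+1 * y t)).
Proof. by move=> tI; exact: is_deriveM_real (dyc tI) (dP tI). Qed.

Let dk (t : R) : t \in I -> is_derive t 1 k (2 * G t / c t ^+ n.+2).
Proof.
move=> tI; have := is_deriveX_real 2 (dyc tI).
by move/is_derive_eq; apply; rewrite /G /= expr1; ring.
Qed.

Let cvg_k (F : set_system R) (x : R) : Filter F ->
  c t @[t --> F] --> c x -> c x != 0 ->
  y t @[t --> F] --> (0 : R) -> k t @[t --> F] --> (0 : R).
Proof.
move=> FF cc cx0 y0.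
have -> : (0 : R) = (0 / c x) * (0 / c x) by rewrite !mul0r.
have -> : k = (fun t => (y t / c t) * (y t / c t)).
  by apply/funext => t; rewrite /k expr2.
by apply: cvgM; (apply: cvgM => //; exact: cvgV).
Qed.

Let c_cont (x : R) : c t @[t --> x] --> c x.
Proof.
by apply/differentiable_continuous/derivable1_diffP; case: (dc x).
Qed.

Lemma neumann_gap : n.+1%:R * a ^+ 2 <= lam.
Proof.
rewrite leNgt; apply/negP => lamlt.
have lam_gt0 : 0 < n.+1%:R * a ^+ 2 - lam by rewrite subr_gt0.
(* The two summands of [G'] are [p h'^2] and [(Lam - lam) p h^2], where [Lam = n.+1%:R * a ^+ 2];
   both are nonnegative when [lam < Lam]. *)
have term_ge0 (t : R) : t \in I -> 0 <= P t / c t ^+ n.+2 * P t.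
  move=> tI; rewrite mulrAC -expr2 divr_ge0// ?sqr_ge0// exprn_ge0//.
  exact/ltW/c_gt0.
have termE (t : R) : t \in I ->
    y t / c t * ((n.+1%:R * a ^+ 2 - lam) * c t ^+ n.+1 * y t)
    = (n.+1%:R * a ^+ 2 - lam) * c t ^+ n * y t ^+ 2.
  by move=> /c_gt0/lt0r_neq0 c0; rewrite [c t ^+ n.+1]exprS; field; exact: c0.
have term2_ge0 (t : R) : t \in I ->
    0 <= (n.+1%:R * a ^+ 2 - lam) * c t ^+ n * y t ^+ 2.
  move=> /c_gt0 c0; apply: mulr_ge0; last exact: sqr_ge0.
  by apply: mulr_ge0; [exact: ltW|exact/exprn_ge0/ltW].
have Gnd : {in I &, {homo G : u v / u <= v}}.
  refine (is_derive_ge0_le dG _) => t tI; rewrite termE//.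
  by apply: addr_ge0; [exact: term_ge0|exact: term2_ge0].
(* The strict bound [a * d < pi / 2] keeps [c] away from 0 at both ends, so that [h = y / c]
   inherits the limit 0 of [y] there. *)
have cd0 : 0 < c d.
  apply: cos_gt0_pihalf; rewrite ad andbT.
  by have := pi_gt0 R; have := mulr_gt0 a0 d0; lra.
have k_gt0 (t : R) : G t != 0 -> 0 < k t.
  rewrite lt0r sqr_ge0 andbT /k sqrf_eq0; apply: contra => /eqP.
  by rewrite /G => ->; rewrite mul0r.
(* If [G t > 0], monotonicity keeps [G] positive on []t, d[]. The derivative of [k] is a positive
   multiple of [G], so [k] is positive and nondecreasing there and cannot tend to 0 at [d]. *)
have G_le0 (t : R) : t \in I -> G t <= 0.
  move=> tI; rewrite leNgt; apply/negP => Gt0.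
  have /andP[t1 t2] : - d < t < d by move: tI; rewrite in_itv.
  have sub (u : R) : u \in `]t, d[ -> u \in I.
    by rewrite !in_itv/= => /andP[? ->]; rewrite andbT; lra.
  have Gu0 (u : R) : u \in `]t, d[ -> 0 < G u.
    move=> ut; apply: (lt_le_trans Gt0); apply: Gnd => //; first exact: sub.
    by move: ut; rewrite in_itv/= => /andP[/ltW].
  have knd : {in `]t, d[ &, {homo k : u v / u <= v}}.
    refine (is_derive_ge0_le (fun u uI => dk (sub u uI)) _) => u uI.
    apply: divr_ge0; first by apply: mulr_ge0 => //; exact/ltW/Gu0.
    exact/exprn_ge0/ltW/c_gt0/sub.
  pose u0 := (t + d) / 2.
  have u0I : u0 \in `]t, d[ by rewrite in_itv/=; apply/andP; split; rewrite /u0; lra.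
  have ku0 := k_gt0 _ (lt0r_neq0 (Gu0 _ u0I)).
  have kd : k t @[t --> d^'-] --> (0 : R).
    by apply: (@cvg_k _ d) => //; [exact/cvg_at_left_filter/c_cont|exact: lt0r_neq0].
  have [u [uI]] : exists u, (u \in `]u0, d[) /\ (k u < k u0).
    near (d^'-)%R => u; exists u; split; last first.
      by near: u; exact: (cvgr_lt 0).
    rewrite in_itv/=; apply/andP; split; near: u; last exact: nbhs_left_lt.
    by apply: nbhs_left_gt; rewrite /u0; lra.
  rewrite ltNge => /negP; apply; apply: knd => //.
    by move: uI u0I; rewrite !in_itv/= => /andP[? ->] /andP[? _]; rewrite andbT; lra.
  by move: uI; rewrite in_itv/= => /andP[/ltW].
(* Mirror argument at the left end: a negative value of [G] makes [k] positive and nonincreasing on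
   [](- d), t[], against its limit 0 at [- d]. *)
have G_ge0 (t : R) : t \in I -> 0 <= G t.
  move=> tI; rewrite leNgt; apply/negP => Gt0.
  have /andP[t1 t2] : - d < t < d by move: tI; rewrite in_itv.
  have sub (u : R) : u \in `](- d), t[ -> u \in I.
    by rewrite !in_itv/= => /andP[-> ?]; lra.
  have Gu0 (u : R) : u \in `](- d), t[ -> G u < 0.
    move=> ut; apply: le_lt_trans Gt0; apply: Gnd => //; first exact: sub.
    by move: ut; rewrite in_itv/= => /andP[_ /ltW].
  have knd : {in `](- d), t[ &, {homo (fun u => - k u) : u v / u <= v}}.
    refine (is_derive_ge0_le (fun u uI => is_deriveN (dk (sub u uI))) _) => u uI.
    rewrite -mulNr; apply: divr_ge0; first by have := Gu0 _ uI; lra.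
    exact/exprn_ge0/ltW/c_gt0/sub.
  pose u0 := (t - d) / 2.
  have u0I : u0 \in `](- d), t[.
    by rewrite in_itv/=; apply/andP; split; rewrite /u0; lra.
  have ku0 := k_gt0 _ (ltr0_neq0 (Gu0 _ u0I)).
  have kd : k t @[t --> (- d)^'+] --> (0 : R).
    apply: (@cvg_k _ (- d)) => //; first exact/cvg_at_right_filter/c_cont.
    by rewrite /c mulrN cosN lt0r_neq0.
  have [u [uI]] : exists u, (u \in `](- d), u0[) /\ (k u < k u0).
    near (- d)^'+ => u; exists u; split; last first.
      by near: u; exact: (cvgr_lt 0).
    rewrite in_itv/=; apply/andP; split; near: u; first exact: nbhs_right_gt.
    by apply: nbhs_right_lt; rewrite /u0; lra.
  rewrite ltNge => /negP; apply; rewrite -lerN2; apply: knd => //.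
    by move: uI u0I; rewrite !in_itv/= => /andP[-> ?] /andP[_ ?]; lra.
  by move: uI; rewrite in_itv/= => /andP[_ /ltW].
have G0 (t : R) : t \in I -> G t = 0.
  by move=> tI; apply/eqP; rewrite eq_le G_le0// G_ge0.
(* As [G] vanishes identically, so do both nonnegative summands of [G']; the second has the positive
   factor [Lam - lam] and forces [y t = 0]. *)
have y0 (t : R) : t \in I -> y t = 0.
  move=> tI.
  have nG : \forall u \near t, cst 0 u = G u.
    by near=> u; rewrite G0//; near: u; exact: near_in_itvoo.
  have [_ h1] := near_eq_is_derive nG (is_derive_cst (0 : R) t (1 : R)).
  have [_] := dG tI; rewrite h1 termE// => /esym/eqP.
  rewrite paddr_eq0//; [|exact: term_ge0|exact: term2_ge0].
  move=> /andP[_]; rewrite mulf_eq0 sqrf_eq0 mulf_eq0 expf_eq0.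
  by rewrite (gt_eqF lam_gt0) (gt_eqF (c_gt0 tI)) andbF/= => /eqP.
(* With [phi' = 0] on the interval the equation reduces to [lam * phi = 0], which fails where [phi]
   is nonzero. *)
have [t tI] := phi_neq0; apply/negP/negPn.
have ny : \forall u \near t, cst 0 u = y u.
  by near=> u; rewrite y0//; near: u; exact: near_in_itvoo.
have [_ h1] := near_eq_is_derive ny (is_derive_cst (0 : R) t (1 : R)).
have [_] := dy tI; rewrite h1 y0// mulr0 sub0r => /esym/eqP.
by rewrite oppr_eq0 mulf_eq0 (negbTE lam0).
Unshelve. all: by end_near. Qed.
End neumann.

(** Domain of the kernel in the integral from 0 to [t]. For fixed [t] it is the segment between 0
    and [t] without 0; for fixed nonzero [x] it is the closed half-line starting at [x] and pointing
    away from 0. *)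
Definition between0 {R : realType} (x t : R) : bool :=
  (0 < x <= t) || (t <= x < 0).

(** * Fundamental theorem of calculus, Cauchy-Schwarz, and a Schur test based on Tonelli *)

Section itv_integrals.
Context {R : realType}.
Local Notation mu := (@lebesgue_measure R).

Lemma is_derive_cvg (F : R -> R) (x df : R) :
  is_derive x (1 : R) F df -> F t @[t --> x] --> F x.
Proof. by move=> [h _]; apply/differentiable_continuous/derivable1_diffP. Qed.

Lemma integral_is_derive (F f : R -> R) (a b : R) : a <= b ->
  (forall x : R, is_derive x (1 : R) F (f x)) -> continuous f ->
  (\int[mu]_(x in `[a, b]) (f x)%:E = (F b - F a)%:E)%E.
Proof.
rewrite le_eqVlt => /predU1P[<- _ _|ab dF cf].
  by rewrite set_itv1 integral_set1 subrr.
apply: continuous_FTC2 => //.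
- exact: continuous_subspaceT.
- split.
  + by move=> x _; case: (dF x).
  + exact/cvg_at_right_filter/is_derive_cvg.
  + exact/cvg_at_left_filter/is_derive_cvg.
- by move=> x _; rewrite derive1E; case: (dF x).
Qed.

Lemma continuous_integrable_itv (f : R -> R) (a b : R) : continuous f ->
  mu.-integrable `[a, b] (EFin \o f).
Proof.
move=> cf; apply: continuous_compact_integrable; first exact: segment_compact.
exact: continuous_subspaceT.
Qed.

(* Cauchy-Schwarz for [f = sqrt q * (f / sqrt q)]. *)
Lemma sqr_integral_le (s e V : R) (f q : R -> R) :
  0 < V -> mu.-integrable `[s, e] (EFin \o f) ->
  mu.-integrable `[s, e] (EFin \o q) -> (\int[mu]_(x in `[s, e]) q x = V) ->
  (forall x, x \in `[s, e] -> 0 < q x) ->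
  measurable_fun `[s, e] (fun x => f x ^+ 2 / q x) ->
  (((\int[mu]_(x in `[s, e]) f x) ^+ 2)%:E
   <= V%:E * \int[mu]_(x in `[s, e]) (f x ^+ 2 / q x)%:E)%E.
Proof.
move=> V0 intf intq qV q0 mfq; set A := (\int[mu]_(x in _) _).
(* The pointwise inequality [f^2 / q >= 2 c f - c^2 q], a rearranged square, is integrated;
   [c = A / V] is the optimal constant and makes the right-hand side integrate to [A^2 / V]. The
   integral of [f^2 / q] is allowed to be infinite. *)
pose c := A / V.
have mI : measurable (`[s, e] : set (measurableTypeR R)) by exact: measurable_itv.
have i1 : mu.-integrable `[s, e] (fun x => (2 * c * f x)%:E).
  exact: (@integrableZl _ _ _ mu _ _ (2 * c) _ intf).
have i2 : mu.-integrable `[s, e] (fun x => (c ^+ 2 * q x)%:E).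
  exact: (@integrableZl _ _ _ mu _ _ (c ^+ 2) _ intq).
pose g x := 2 * c * f x - c ^+ 2 * q x.
have ig : mu.-integrable `[s, e] (EFin \o g) by exact: (integrableB mI i1 i2).
have Ig : \int[mu]_(x in `[s, e]) g x = A ^+ 2 / V.
  rewrite RintegralB// !RintegralZl// qV -/A /c; field; exact: lt0r_neq0.
have -> : (A ^+ 2)%:E = (V%:E * (A ^+ 2 / V)%:E)%E.
  by rewrite -EFinM mulrC divfK// lt0r_neq0.
rewrite lee_pmul2l// -Ig /Rintegral fineK; last exact: integrable_fin_num.
(* The minorant [g] may be negative; its positive part is still below [f^2 / q], which brings the
   comparison back to nonnegative functions. *)
apply: (@le_trans _ _ (\int[mu]_(x in `[s, e]) ((EFin \o g)^\+ x))%E).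
  apply: le_integral => //; first exact: integrable_funepos.
  by move=> x _; rewrite funeposE le_max lexx.
apply: ge0_le_integral => //.
- by apply: measurable_funepos; exact: measurable_int ig.
- exact/measurable_EFinP.
- move=> x xI; rewrite funeposE ge_max/= lee_fin; apply/andP; split; last first.
    by rewrite lee_fin divr_ge0 ?sqr_ge0// ltW// q0.
  have q0x : 0 < q x by exact: q0.
  rewrite /g -subr_ge0.
  have -> : f x ^+ 2 / q x - (2 * c * f x - c ^+ 2 * q x)
      = (f x - c * q x) ^+ 2 / q x.
    by field; exact: lt0r_neq0.
  by rewrite divr_ge0 ?sqr_ge0// ltW.
Qed.

(** Both integrals are the double integral of [h t * g x] over the pairs with [between0 x t], taken
    in the two orders; by nonnegativity the equality holds in the extended reals. *)
Lemma tonelli_between0 (h g : R -> R) :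
  measurable_fun setT h -> measurable_fun setT g ->
  (forall x, 0 <= h x) -> (forall x, 0 <= g x) ->
  let H t := ((h t)%:E * \int[mu]_(x in [set x | between0 x t]) (g x)%:E)%E in
  let G x := ((g x)%:E * \int[mu]_(t in [set t | between0 x t]) (h t)%:E)%E in
  [/\ measurable_fun setT H, measurable_fun setT G &
      (\int[mu]_t H t = \int[mu]_x G x)%E].
Proof.
move=> mh mg h0 g0 H G.
pose f (z : measurableTypeR R * measurableTypeR R) : \bar R :=
  (h z.1 * (if between0 z.2 z.1 then g z.2 else 0))%:E.
have mab : measurable_fun [set: measurableTypeR R * measurableTypeR R]
    (fun z => between0 z.2 z.1).
  by apply: measurable_or; apply: measurable_and;
    (exact: measurable_fun_ltr || exact: measurable_fun_ler).
have mf : measurable_fun setT f.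
  apply/measurable_EFinP/measurable_funM; first exact: measurableT_comp.
  apply: measurable_fun_ifT => //; exact: measurableT_comp.
have f0 z : (0 <= f z)%E.
  by rewrite lee_fin mulr_ge0//; case: ifP.
have mset (b : R -> bool) : measurable_fun setT b ->
    measurable ([set x | b x] : set (measurableTypeR R)).
  by move=> /(_ measurableT [set true] I); rewrite setTI.
have mabt t : measurable ([set x | between0 x t] : set (measurableTypeR R)).
  apply: mset; apply: measurable_or; apply: measurable_and;
    (apply: measurable_fun_ltr || apply: measurable_fun_ler) => //.
have mabx x : measurable ([set t | between0 x t] : set (measurableTypeR R)).
  apply: mset; apply: measurable_or; apply: measurable_and;
    (apply: measurable_fun_ltr || apply: measurable_fun_ler) => //.
have patchE (u : R -> R) (A : set R) (r : R) (x : R) : 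
    (r%:E * ((fun x => (u x)%:E) \_ A) x = (r * (if x \in A then u x else 0))%:E)%E.
  by rewrite /patch; case: ifP => _; rewrite ?mule0 ?mulr0// EFinM.
have intE (u : R -> R) (A : set (measurableTypeR R)) (r : R) :
    measurable A -> measurable_fun setT u ->
    (forall x, 0 <= u x) -> 0 <= r ->
    (r%:E * \int[mu]_(x in A) (u x)%:E
     = \int[mu]_x (r * (if x \in A then u x else 0))%:E)%E.
  move=> mA mu_ u0 r0; rewrite integral_mkcond -ge0_integralZl//.
  - by apply: eq_integral => x _; rewrite patchE.
  - apply/(measurable_restrictT _ mA)/measurable_EFinP.
    exact: measurable_funTS.
  - by move=> x _; rewrite /patch; case: ifP => _//; rewrite lee_fin.
have HE t : H t = (\int[mu]_x f (t, x))%E.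
  rewrite /H intE//; apply: eq_integral => x _.
  rewrite [in LHS](_ : (x \in _) = between0 x t)//.
  by apply/idP/idP; rewrite inE.
have GE x : G x = (\int[mu]_t f (t, x))%E.
  rewrite /G intE//; apply: eq_integral => t _.
  rewrite [in LHS](_ : (t \in _) = between0 x t); last by apply/idP/idP; rewrite inE.
  by rewrite /f/=; case: ifP => _; rewrite ?mulr0// mulrC.
split.
- rewrite (funext HE); exact: (@measurable_fun_fubini_tonelli_F _ _ _ _ R mu f mf f0).
- rewrite (funext GE); exact: (@measurable_fun_fubini_tonelli_G _ _ _ _ R mu f mf f0).
- rewrite (funext HE) (funext GE).
  exact: (@fubini_tonelli _ _ _ _ R mu mu f mf f0).
Qed.

(** Schur test: bound [psi] by the kernel, exchange the integrals, then bound the inner integral in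
    [t] for each [x]. Since [g] vanishes off [D], only [x] in [D] contribute after the exchange. *)
Lemma schur_between0 (D : set (measurableTypeR R)) (h g psi f : R -> R) (k : R) :
  measurable D -> measurable_fun setT h -> measurable_fun setT g ->
  (forall x, 0 <= h x) -> (forall x, 0 <= g x) ->
  measurable_fun D psi -> (forall t, D t -> 0 <= psi t) ->
  measurable_fun D f -> (forall x, D x -> 0 <= f x) -> 0 <= k ->
  (forall t, D t ->
    (psi t)%:E <= (h t)%:E * \int[mu]_(x in [set x | between0 x t]) (g x)%:E)%E ->
  (forall x, ~ D x -> g x = 0) ->
  (forall x, D x ->
    (g x)%:E * \int[mu]_(t in [set t | between0 x t]) (h t)%:E <= (k * f x)%:E)%E ->
  (\int[mu]_(t in D) (psi t)%:E <= k%:E * \int[mu]_(x in D) (f x)%:E)%E.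
Proof.
move=> mD mh mg h0 g0 mpsi psi0 mf f0 k0 psi_le g_out f_ge.
have [mH mG E] := tonelli_between0 mh mg h0 g0.
have I0 (u : R -> R) (A : set R) : (forall x, 0 <= u x) ->
    (0 <= \int[mu]_(x in A) (u x)%:E)%E.
  by move=> u0; apply: integral_ge0 => x _; rewrite lee_fin.
rewrite integral_mkcond; apply: (@le_trans _ _ (\int[mu]_t
    ((h t)%:E * \int[mu]_(x in [set x | between0 x t]) (g x)%:E))%E).
  apply: ge0_le_integral => //.
  - by move=> t _; rewrite patchE; case: ifPn => // /set_mem /psi0; rewrite lee_fin.
  - exact/(measurable_restrictT _ mD)/measurable_EFinP.
  - move=> t _; rewrite patchE; case: ifPn => [/set_mem|_]; first exact: psi_le.
    by apply: mule_ge0; [rewrite lee_fin|exact: I0].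
rewrite E -ge0_integralZl//=; last exact/measurable_EFinP.
rewrite [leRHS]integral_mkcond; apply: ge0_le_integral => //.
- by move=> x _; apply: mule_ge0; [rewrite lee_fin|exact: I0].
- exact/(measurable_restrictT _ mD)/measurable_EFinP/measurable_funM.
- move=> x _; rewrite patchE; case: ifPn => [/set_mem|xD]; first exact: f_ge.
  by rewrite g_out ?mul0e// => /mem_set; exact/negP.
Qed.

End itv_integrals.

(** * Weighted Poincare inequality when the weight is built on a cosine vanishing at both ends *)

Section weighted_poincare.
Context {R : realType} (n : nat) (a d : R) (phi dphi : R -> R).
Local Notation mu := (@lebesgue_measure R).
Local Notation I := `](- d), d[.
Hypotheses (a0 : 0 < a) (ad : a * d = pi / 2).
Let s (t : R) : R := sin (a * t).
Let c (t : R) : R := cos (a * t).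
Let w (t : R) : R := c t ^+ n.
Hypothesis phi_primitive : forall u v : R, - d < u -> u <= v -> v < d ->
  mu.-integrable `[u, v] (EFin \o dphi) /\
  phi v - phi u = \int[mu]_(t in `[u, v]) dphi t.
Hypothesis dphi_L2 : mu.-integrable [set` I] (fun t => (dphi t ^+ 2 * w t)%:E).

Let d0 : 0 < d.
Proof. by rewrite -(pmulr_rgt0 _ a0) ad divr_gt0// pi_gt0. Qed.

Let ds (t : R) : is_derive t 1 s (a * c t).
Proof. exact: is_derive_sinM. Qed.

Let dc (t : R) : is_derive t 1 c (- (a * s t)).
Proof. exact: is_derive_cosM. Qed.

Let s_cont : continuous s.
Proof. by move=> t; exact: is_derive_cvg (ds t). Qed.

Let c_cont : continuous c.
Proof. by move=> t; exact: is_derive_cvg (dc t). Qed.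

Let w_cont : continuous w.
Proof. by move=> t; apply: is_derive_cvg (is_deriveX_real n (dc t)). Qed.

Let c_gt0 (t : R) : t \in I -> 0 < c t.
Proof. by apply: cosM_gt0; rewrite // ad. Qed.

Let cd : c d = 0. Proof. by rewrite /c ad cos_pihalf. Qed.

Let cNd : c (- d) = 0. Proof. by rewrite /c mulrN cosN. Qed.

Lemma primitive_continuous : {in [set` I], continuous phi}.
Proof.
move=> x /set_mem/=; rewrite in_itv/= => /andP[x1 x2].
(* The points [u] and [v] are midpoints between [x] and the two ends: integrability of [dphi] is
   only available on compact subintervals of the open interval. *)
pose u := (x - d) / 2; pose v := (x + d) / 2.
have uI : - d < u by rewrite /u; lra.
have vI : v < d by rewrite /v; lra.
have ux : u < x by rewrite /u; lra.
have xv : x < v by rewrite /v; lra.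
have [iuv _] := phi_primitive uI (ltW (lt_trans ux xv)) vI.
have := parameterized_integral_continuous (ltW (lt_trans ux xv)) iuv.
have sub : `]u, v[%classic `<=` `[u, v]%classic by exact: subset_itv_oo_cc.
move=> /(continuous_subspaceW sub); rewrite continuous_open_subspace//.
move=> /(_ x); rewrite inE/= in_itv/= ux xv => /(_ isT) h.
have : {for x, continuous (fun y => phi u + \int[mu]_(t in `[u, y]) dphi t)}.
  by apply: cvgD => //; exact: cvg_cst.
rewrite /prop_for /continuous_at -(phi_primitive uI (ltW ux) (lt_trans xv vI)).2.
rewrite [X in _ --> X -> _]addrC subrK; apply: cvg_trans; apply: near_eq_cvg.
near=> y.
have : y \in `]u, v[ by near: y; apply: near_in_itvoo; rewrite in_itv/= ux.
rewrite in_itv/= => /andP[/ltW uy yv].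
by rewrite -(phi_primitive uI uy (lt_trans yv vI)).2 addrC subrK.
Unshelve. all: by end_near. Qed.

(** On the interval this is [dphi^2 / (a c)], see [gE]; the uncancelled form reduces its
    measurability to that of [dphi^2 w], which comes with the integrability hypothesis. *)
Let g : R -> R := (fun x => dphi x ^+ 2 * w x / (a * c x ^+ n.+1)) \_ [set` I].
Let h : R -> R := (fun t => w t * `|s t|) \_ [set` I].

Let c_ge0 (t : R) : t \in `[(- d), d] -> 0 <= c t.
Proof.
rewrite in_itv/= => /andP[t1 t2].
by apply: cos_ge0_pihalf; rewrite -ad -mulrN !ler_pM2l// t1.
Qed.

Let w_ge0 (t : R) : t \in `[(- d), d] -> 0 <= w t.
Proof. by move=> /c_ge0; exact: exprn_ge0. Qed.

Let w_gt0 (t : R) : t \in I -> 0 < w t.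
Proof. by move=> /c_gt0; exact: exprn_gt0. Qed.

Let gE (x : R) : x \in I -> g x = dphi x ^+ 2 / (a * c x).
Proof.
move=> xI; rewrite /g patchE mem_setE xI /w [c x ^+ n.+1]exprS.
have c0 := lt0r_neq0 (c_gt0 xI).
have cn0 : c x ^+ n != 0 by rewrite expf_neq0.
move: (c x ^+ n) cn0 => Z Z0.
by field; rewrite c0 Z0 lt0r_neq0.
Qed.

Let g_ge0 (x : R) : 0 <= g x.
Proof.
have [xI|xI] := boolP (x \in I); last by rewrite /g patchE mem_setE (negbTE xI).
by rewrite gE// divr_ge0 ?sqr_ge0// mulr_ge0// ltW// c_gt0.
Qed.

Let h_ge0 (x : R) : 0 <= h x.
Proof.
have [xI|xI] := boolP (x \in I); rewrite /h patchE mem_setE;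
  last by rewrite (negbTE xI).
by rewrite xI mulr_ge0// ltW// w_gt0.
Qed.

Let mI : measurable ([set` I] : set (measurableTypeR R)).
Proof. exact: measurable_itv. Qed.

Let mg : measurable_fun setT g.
Proof.
apply/(measurable_restrictT _ mI); apply: measurable_funM.
  by apply/measurable_EFinP; exact: measurable_int dphi_L2.
apply: open_continuous_measurable_fun; first exact: interval_open.
move=> x; rewrite inE/= => /c_gt0 cx0; apply: cvgV.
  by rewrite mulf_neq0 ?lt0r_neq0// exprn_gt0.
apply: cvgM; first exact: cvg_cst.
by apply: is_derive_cvg (is_deriveX_real n.+1 (dc x)).
Qed.

Let ws_cont : continuous (fun t => w t * `|s t|).
Proof.
move=> x; apply: cvgM; first exact: w_cont.
by apply: cvg_norm; exact: s_cont.
Qed.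

Let mh : measurable_fun setT h.
Proof.
apply/(measurable_restrictT _ mI); apply: measurable_funTS.
exact: continuous_measurable_fun ws_cont.
Qed.

(** Cauchy-Schwarz with the weight [q = a c], whose integral over [[u, v]] is [s v - s u] because
    [s' = a c]. *)
Let sqr_increment_le (u v : R) : - d < u -> u < v -> v < d ->
  (((phi v - phi u) ^+ 2)%:E
   <= (s v - s u)%:E * \int[mu]_(x in `[u, v]) (g x)%:E)%E.
Proof.
move=> du uv vd; have [intf ->] := phi_primitive du (ltW uv) vd.
have sub (x : R) : x \in `[u, v] -> x \in I.
  by rewrite !in_itv/= => /andP[? ?]; apply/andP; split; lra.
have acc : continuous (fun x => a * c x).
  by move=> x; apply: cvgM; [exact: cvg_cst|exact: c_cont].
have suv : s u < s v.
  rewrite ltr_sin ?ltr_pM2l//; rewrite in_itv/= -ad -mulrN !ler_pM2l//;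
    apply/andP; split; lra.
rewrite [X in (_ <= _ * X)%E](_ : _ =
  \int[mu]_(x in `[u, v]) (dphi x ^+ 2 / (a * c x))%:E)%E.
  apply: sqr_integral_le => //.
  - by rewrite subr_gt0.
  - exact: continuous_integrable_itv.
  - by rewrite /Rintegral (integral_is_derive (ltW uv) ds).
  - by move=> x /sub/c_gt0; exact: mulr_gt0.
  - apply: (eq_measurable_fun g) => [x|]; first by rewrite inE/= => /sub/gE.
    exact: measurable_funTS.
by apply: eq_integral => x; rewrite inE/= => /sub/gE ->.
Qed.

Let s_ge0 (t : R) : 0 <= t -> t <= d -> 0 <= s t.
Proof.
move=> t0 td; apply: sin_ge0_pi; rewrite mulr_ge0 ?(ltW a0)//=.
apply: (@le_trans _ _ (a * d)); first by rewrite ler_pM2l.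
by rewrite ad; have := pi_gt0 R; lra.
Qed.

Let s_le0 (t : R) : t <= 0 -> - d <= t -> s t <= 0.
Proof.
by move=> t0 td; rewrite -oppr_ge0 /s -sinN -mulrN; apply: s_ge0; lra.
Qed.

(** The previous bound with one end at 0, where [s] vanishes; the kernel domain differs from the
    closed segment only by the null set containing 0. *)
Let sqr_increment0_le (t : R) : t \in I ->
  (((phi t - phi 0) ^+ 2)%:E
   <= `|s t|%:E * \int[mu]_(x in [set x | between0 x t]) (g x)%:E)%E.
Proof.
move=> tI; move: (tI); rewrite in_itv/= => /andP[t1 t2].
have s0 : s 0 = 0 by rewrite /s mulr0 sin0.
have Nd0 : - d < 0 by rewrite oppr_lt0.
have mgD (D : set (measurableTypeR R)) : measurable_fun D (EFin \o g).
  by apply/measurable_EFinP; exact: measurable_funTS.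
have [t0|t0|<-] := ltgtP 0 t.
- have -> : [set x : R | between0 x t] = `]0, t]%classic.
    apply/seteqP; split => x; rewrite /= in_itv/= /between0.
      by move=> /orP[//|/andP[tx x0]]; have := lt_le_trans t0 tx; lra.
    by move=> ->.
  rewrite integral_itv_obnd_cbnd; last exact: mgD.
  rewrite ger0_norm ?s_ge0 ?(ltW t0) ?(ltW t2)//.
  by have := sqr_increment_le Nd0 t0 t2; rewrite s0 subr0.
- have -> : [set x : R | between0 x t] = `[t, 0[%classic.
    apply/seteqP; split => x; rewrite /= in_itv/= /between0.
      by move=> /orP[/andP[x0 xt]|//]; have := lt_le_trans x0 xt; lra.
    by move=> ->; rewrite orbT.
  rewrite integral_itv_bndo_bndc; last exact: mgD.
  rewrite ler0_norm ?s_le0 ?(ltW t0) ?(ltW t1)//.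
  by have := sqr_increment_le t1 t0 d0; rewrite s0 sub0r -[phi 0 - phi t]opprB sqrrN.
- by rewrite subrr expr0n/= s0 normr0 mul0e.
Qed.

(** The function [c^(n+1) / ((n+1) a)] is a primitive of [- w s] and vanishes at both ends, so only
    its value at [x] survives. For [x = 0] the domain is empty. *)
Let tail_integral (x : R) : x \in I ->
  (\int[mu]_(t in [set t | between0 x t]) (h t)%:E
   <= (c x ^+ n.+1 / (n.+1%:R * a))%:E)%E.
Proof.
move=> xI; move: (xI); rewrite in_itv/= => /andP[x1 x2].
have sgn (t : R) : t \in `[(- d), d] -> `|s t| = if 0 <= t then s t else - s t.
  rewrite in_itv/= => /andP[t1 t2]; case: leP => t0.
    by rewrite ger0_norm// s_ge0.
  by rewrite ler0_norm// s_le0// ltW.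
(* Since [h] vanishes off the open interval, the half-line can be replaced by a compact interval
   covering its relevant part, where the integrand is the continuous function [w |s|]. *)
have step (A : set R) (B : interval R) :
    measurable (A : set (measurableTypeR R)) -> A `&` [set` I] `<=` [set` B] ->
    {subset B <= `[(- d), d]} ->
    (\int[mu]_(t in A) (h t)%:E
     <= \int[mu]_(t in [set` B]) (w t * `|s t|)%:E)%E.
  move=> mA AB Bd.
  have -> : (\int[mu]_(t in A) (h t)%:E
     = \int[mu]_(t in A `&` [set` I]) (w t * `|s t|)%:E)%E.
    rewrite integral_mkcondr; apply: eq_integral => t _.
    by rewrite /h !patchE; case: ifP.
  apply: ge0_subset_integral => //; first exact: measurableI.
    apply/measurable_EFinP; apply: measurable_funTS.
    exact: continuous_measurable_fun.
  by move=> t /= /Bd tB; rewrite lee_fin mulr_ge0// w_ge0.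
pose F t := c t ^+ n.+1 / (n.+1%:R * a).
have dF (t : R) : is_derive t (1 : R) F (- (w t * s t)).
  have := is_deriveM_real (is_deriveX_real n.+1 (dc t))
    (is_derive_cst (n.+1%:R * a)^-1 t (1:R)).
  move/is_derive_eq; apply; rewrite /cst mulr0 addr0 /=/w.
  by field; rewrite lt0r_neq0//= lt0r_neq0// ltr_pwDr.
have wscont : continuous (fun t => w t * s t).
  by move=> t; apply: cvgM; [exact: w_cont|exact: s_cont].
have Fd : F d = 0 by rewrite /F cd expr0n mul0r.
have FNd : F (- d) = 0 by rewrite /F cNd expr0n mul0r.
have [x0|x0|<-] := ltgtP 0 x.
- have -> : [set t : R | between0 x t] = `[x, +oo[%classic.
    apply/seteqP; split => t; rewrite /= in_itv/= /between0 x0 andbT/=.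
      by move=> /orP[//|/andP[_]]; lra.
    by move=> ->.
  apply: (le_trans (step _ `[x, d] _ _ _)) => //.
  + by move=> t [/=]; rewrite !in_itv/= andbT => -> /andP[_ /ltW].
  + by move=> t; rewrite !in_itv/= => /andP[? ->]; rewrite andbT; lra.
  + have -> : (\int[mu]_(t in `[x, d]) (w t * `|s t|)%:E
        = \int[mu]_(t in `[x, d]) (- - (w t * s t))%:E)%E.
      apply: eq_integral => t; rewrite inE/= in_itv/= => /andP[xt td]; rewrite opprK sgn.
        by rewrite (le_trans (ltW x0) xt).
      by rewrite in_itv/= td andbT; lra.
    rewrite (integral_is_derive (ltW x2) (fun t => is_deriveN (dF t))).
      by rewrite !fctE Fd oppr0 sub0r opprK.
    by move=> t; apply: cvgN; apply: cvgN; exact: wscont.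
- have -> : [set t : R | between0 x t] = `]-oo, x]%classic.
    apply/seteqP; split => t; rewrite /= in_itv/= /between0 x0 andbT/=.
      by move=> /orP[/andP[]|//]; lra.
    by move=> ->; rewrite orbT.
  apply: (le_trans (step _ `[(- d), x] _ _ _)) => //.
  + by move=> t [/=]; rewrite !in_itv/= => -> /andP[/ltW ->].
  + by move=> t; rewrite !in_itv/= => /andP[-> ?]; lra.
  + have -> : (\int[mu]_(t in `[(- d)%R, x]) (w t * `|s t|)%:E
        = \int[mu]_(t in `[(- d)%R, x]) (- (w t * s t))%:E)%E.
      apply: eq_integral => t; rewrite inE/= in_itv/= => /andP[xt tx]; rewrite sgn.
        by rewrite leNgt (le_lt_trans tx x0)/= mulrN.
      by rewrite in_itv/= xt; lra.
    rewrite (integral_is_derive (ltW x1) dF) ?FNd ?subr0//.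
    by move=> t; apply: cvgN; exact: wscont.
- have -> : [set t : R | between0 0 t] = set0.
    by apply/seteqP; split => t //=; rewrite /between0 ltxx andbF.
  rewrite integral_set0 lee_fin /c mulr0 cos0 expr1n.
  by rewrite divr_ge0// mulr_ge0// ltW.
Qed.

Let mphi : measurable_fun ([set` I] : set (measurableTypeR R)) phi.
Proof.
apply: open_continuous_measurable_fun; first exact: interval_open.
exact: primitive_continuous.
Qed.

Let mw : measurable_fun ([set` I] : set (measurableTypeR R)) w.
Proof. by apply: measurable_funTS; exact: continuous_measurable_fun. Qed.

(** Schur test with [h = w |s|]: in the product of [g x] with the tail bound the powers of [c]
    cancel, leaving [dphi^2 w / ((n+1) a^2)]. *)
Let poincare0 :
  (\int[mu]_(t in [set` I]) ((phi t - phi 0) ^+ 2 * w t)%:E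
   <= ((n.+1%:R * a ^+ 2)^-1)%:E * \int[mu]_(t in [set` I]) (dphi t ^+ 2 * w t)%:E)%E.
Proof.
apply: (schur_between0 mI mh mg h_ge0 g_ge0).
- apply: measurable_funM; last exact: mw.
  apply: measurable_funX.
  by apply: measurable_funB; [exact: mphi|exact: measurable_cst].
- by move=> t /w_gt0/ltW wt; rewrite mulr_ge0 ?sqr_ge0.
- by apply/measurable_EFinP; exact: measurable_int dphi_L2.
- by move=> t /w_gt0/ltW wt; rewrite mulr_ge0 ?sqr_ge0.
- by rewrite invr_ge0 mulr_ge0 ?sqr_ge0.
- move=> t tI; rewrite /h patchE mem_setE tI mulrC EFinM [(w t * _)%:E]EFinM -muleA.
  apply: lee_pmul; last exact: sqr_increment0_le; last exact: lexx.
    by rewrite lee_fin; exact/ltW/w_gt0.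
  by rewrite lee_fin; exact: sqr_ge0.
- by move=> x /negP xI; rewrite /g patchE mem_setE (negbTE xI).
- move=> x xI.
  apply: (@le_trans _ _ ((g x)%:E * (c x ^+ n.+1 / (n.+1%:R * a))%:E)%E).
    by apply: lee_pmul; [rewrite lee_fin|apply: integral_ge0 => t _; rewrite lee_fin|
      exact: lexx|exact: tail_integral].
  rewrite -EFinM lee_fin le_eqVlt; apply/orP; left; apply/eqP.
  rewrite /g patchE mem_setE xI.
  have cn0 : c x ^+ n.+1 != 0 by rewrite expf_neq0//; exact/lt0r_neq0/c_gt0.
  have n0 : n.+1%:R != 0 :> R by [].
  move: (c x ^+ n.+1) cn0 (n.+1%:R : R) n0 => Z Z0 N N0.
  by field; rewrite N0 Z0 lt0r_neq0.
Qed.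

Let wI : mu.-integrable [set` I] (EFin \o w).
Proof.
apply: (integrableS _ mI _ (continuous_integrable_itv (- d) d w_cont)).
  exact: measurable_itv.
exact: subset_itv_oo_cc.
Qed.

(** Follows from [2 |phi| <= phi^2 + 1], the weight being integrable on a bounded interval. *)
Lemma integrable_mul_weight :
  mu.-integrable [set` I] (fun t => (phi t ^+ 2 * w t)%:E) ->
  mu.-integrable [set` I] (fun t => (phi t * w t)%:E).
Proof.
move=> phi_L2.
apply: (@le_integrable _ _ _ mu _ mI _ (fun t => (phi t ^+ 2 * w t + w t)%:E)).
- by apply/measurable_EFinP/measurable_funM.
- move=> t /w_gt0 wt.
  have -> : phi t ^+ 2 * w t + w t = (phi t ^+ 2 + 1) * w t by rewrite mulrDl mul1r.
  rewrite lee_fin !normrM ler_wpM2r// [leRHS]ger0_norm ?addr_ge0 ?sqr_ge0//.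
  have := sqr_ge0 (`|phi t| - 1); rewrite sqrrB1 real_normK ?num_real//.
  by have := normr_ge0 (phi t); lra.
- exact: (integrableD mI phi_L2 wI).
Qed.

(** In the expansion of [(phi - phi 0)^2 w] the mean-zero condition kills the cross term, and the
    constant term only adds a nonnegative amount to the integral of [phi^2 w]. *)
Lemma weighted_poincare :
  mu.-integrable [set` I] (fun t => (phi t ^+ 2 * w t)%:E) ->
  \int[mu]_(t in [set` I]) (phi t * w t) = 0 ->
  n.+1%:R * a ^+ 2 * \int[mu]_(t in [set` I]) (phi t ^+ 2 * w t)
    <= \int[mu]_(t in [set` I]) (dphi t ^+ 2 * w t).
Proof.
move=> phi_L2 mean0; set k := phi 0.
have i1 := integrable_mul_weight phi_L2.
have i2 : mu.-integrable [set` I] (EFin \o (fun t => 2 * k * (phi t * w t))).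
  exact: (@integrableZl _ _ _ mu _ mI (2 * k) _ i1).
have i3 : mu.-integrable [set` I] (EFin \o (fun t => k ^+ 2 * w t)).
  exact: (@integrableZl _ _ _ mu _ mI (k ^+ 2) _ wI).
have i4 := integrableB mI phi_L2 i2.
have i5 := integrableD mI i4 i3.
have sqrE (t : R) : (phi t - k) ^+ 2 * w t
    = phi t ^+ 2 * w t - 2 * k * (phi t * w t) + k ^+ 2 * w t by ring.
have i6 : mu.-integrable [set` I] (EFin \o (fun t => (phi t - k) ^+ 2 * w t)).
  by rewrite (funext sqrE); exact: i5.
have E : \int[mu]_(t in [set` I]) ((phi t - k) ^+ 2 * w t)
  = \int[mu]_(t in [set` I]) (phi t ^+ 2 * w t)
    + k ^+ 2 * \int[mu]_(t in [set` I]) w t.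
  rewrite (funext sqrE) (RintegralD mI i4 i3) (RintegralB mI phi_L2 i2).
  by rewrite (RintegralZl _ mI i1) (RintegralZl _ mI wI) mean0 mulr0 subr0.
have toE (u : R -> R) : mu.-integrable [set` I] (EFin \o u) ->
    (\int[mu]_(t in [set` I]) (u t)%:E = (\int[mu]_(t in [set` I]) u t)%:E)%E.
  by move=> iu; rewrite /Rintegral fineK//; exact: integrable_fin_num.
have := poincare0; rewrite (toE _ i6) (toE _ dphi_L2) -EFinM lee_fin E.
have L0 : 0 < n.+1%:R * a ^+ 2 by rewrite mulr_gt0// exprn_gt0.
rewrite [leRHS]mulrC ler_pdivlMr// mulrC => le1; apply: le_trans le1.
rewrite ler_pM2l// lerDl mulr_ge0 ?sqr_ge0//; apply: Rintegral_ge0 => t.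
by move=> /w_gt0/ltW.
Qed.

(** Makes the denominator of the Rayleigh quotient positive: by continuity [phi^2 w] exceeds half
    its value at [t0] on an interval of positive length. *)
Lemma integral_sqr_weight_gt0 (t0 : R) : t0 \in I -> phi t0 != 0 ->
  mu.-integrable [set` I] (fun t => (phi t ^+ 2 * w t)%:E) ->
  0 < \int[mu]_(t in [set` I]) (phi t ^+ 2 * w t).
Proof.
move=> t0I phit0 phi_L2; pose f t := phi t ^+ 2 * w t.
have ft0 : 0 < f t0 by rewrite mulr_gt0 ?w_gt0// exprn_even_gt0.
have f_cont : {for t0, continuous f}.
  have phi_cont : {for t0, continuous phi}.
    by apply: primitive_continuous; rewrite inE.
  apply: cvgM; last exact: w_cont.
  by rewrite [X in X @ _ --> _](_ : _ = fun t => phi t * phi t)//; apply: cvgM.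
have : \forall t \near t0, (f t0 / 2 < f t) /\ (t \in I).
  near=> t; split; near: t; last exact: near_in_itvoo.
  by apply: (cvgr_gt _ f_cont); rewrite ltr_pdivrMr// mulr2n mulrDr mulr1 ltrDl.
move=> /nbhs_ballP[e /= e0 he].
have inB (t : R) : t \in `[t0, t0 + e / 2] -> (f t0 / 2 < f t) /\ (t \in I).
  rewrite in_itv/= => /andP[t1 t2]; apply: he; rewrite /ball/= ler0_norm; lra.
have mJ : measurable (`[t0, t0 + e / 2]%classic : set (measurableTypeR R)).
  exact: measurable_itv.
have JI : `[t0, t0 + e / 2]%classic `<=` [set` I] by move=> t /= /inB[].
have toE : (\int[mu]_(t in [set` I]) (f t)%:E = (\int[mu]_(t in [set` I]) f t)%:E)%E.
  by rewrite /Rintegral fineK//; exact: integrable_fin_num.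
rewrite -/f -lte_fin -toE.
apply: (@lt_le_trans _ _
  (\int[mu]_(t in `[t0, (t0 + e / 2)%R]) (f t)%:E)%E); last first.
  apply: ge0_subset_integral => //; first exact: measurable_int phi_L2.
  by move=> t /= /w_gt0/ltW wt; rewrite lee_fin mulr_ge0 ?sqr_ge0.
apply: (@lt_le_trans _ _ (\int[mu]_(t in `[t0, (t0 + e / 2)%R]) (f t0 / 2)%:E)%E).
  have -> : (\int[mu]_(t in `[t0, (t0 + e / 2)%R]) (f t0 / 2)%:E
      = (f t0 / 2 * (t0 + e / 2) - f t0 / 2 * t0)%:E)%E.
    apply: (@integral_is_derive _ (fun t => f t0 / 2 * t) (fun=> f t0 / 2)).
    - by rewrite lerDl divr_ge0// ltW.
    - move=> t; have := is_deriveM_real (is_derive_cst (f t0 / 2) t (1 : R))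
        (is_derive_id t (1 : R)).
      by move/is_derive_eq; apply; rewrite mul0r add0r mulr1.
    - by move=> t; exact: cvg_cst.
  by rewrite lte_fin -mulrBr addrAC subrr add0r mulr_gt0// divr_gt0.
apply: ge0_le_integral => //.
- by move=> t _; rewrite lee_fin divr_ge0// ltW.
- by apply: measurable_funS (measurable_int _ phi_L2).
- by move=> t /= /inB[/ltW]; rewrite lee_fin.
Unshelve. all: by end_near. Qed.

End weighted_poincare.

(** * The infimum of the Rayleigh quotient, attained by the sine *)

Section rayleigh.
Context {R : realType} (n : nat) (a D : R).
Local Notation mu := (@lebesgue_measure R).
Local Notation d := (D / 2).
Local Notation I := `](- d), d[.
Hypotheses (a0 : 0 < a) (aD : a * D = pi).
Let s (t : R) : R := sin (a * t).
Let c (t : R) : R := cos (a * t).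
Let w (t : R) : R := c t ^+ n.

Let ad : a * d = pi / 2. Proof. by rewrite mulrA aD. Qed.

Let D0 : 0 < D. Proof. by rewrite -(pmulr_rgt0 _ a0) aD pi_gt0. Qed.

Let ds (t : R) : is_derive t 1 s (a * c t).
Proof. exact: is_derive_sinM. Qed.

Let dc (t : R) : is_derive t 1 c (- (a * s t)).
Proof. exact: is_derive_cosM. Qed.

Let s_cont : continuous s.
Proof. by move=> t; exact: is_derive_cvg (ds t). Qed.

Let c_cont : continuous c.
Proof. by move=> t; exact: is_derive_cvg (dc t). Qed.

Let cX_cont j : continuous (fun t => c t ^+ j).
Proof. by move=> t; apply: is_derive_cvg (is_deriveX_real j (dc t)). Qed.

Let ac_cont : continuous (fun t => a * c t).
Proof. by move=> t; apply: cvgM; [exact: cvg_cst|exact: c_cont]. Qed.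

Let mI : measurable ([set` I] : set (measurableTypeR R)).
Proof. exact: measurable_itv. Qed.

Let continuous_integrable_I (f : R -> R) : continuous f ->
  mu.-integrable [set` I] (EFin \o f).
Proof.
move=> cf; apply: (integrableS _ mI _ (continuous_integrable_itv (- d) d cf)).
  exact: measurable_itv.
exact: subset_itv_oo_cc.
Qed.

Let Rintegral_I (F f : R -> R) :
  (forall x : R, is_derive x (1 : R) F (f x)) -> continuous f ->
  \int[mu]_(t in [set` I]) f t = F d - F (- d).
Proof.
move=> dF cf; have intf := continuous_integrable_I cf.
rewrite Rintegral_itv_bndo_bndc// Rintegral_itv_obnd_cbnd//; last first.
  apply: (integrableS _ _ _ (continuous_integrable_itv (- d) d cf)) => //.
  by apply: subset_itv; rewrite bnd_simp.
have dd : - d <= d by have := D0; lra.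
by rewrite /Rintegral (integral_is_derive dd dF cf).
Qed.

Let sin_H1 : weighted_H1 D w s (fun t => a * c t).
Proof.
split.
- move=> u v _ uv _; split; first exact: continuous_integrable_itv.
  by rewrite /Rintegral (integral_is_derive uv ds ac_cont).
- apply: continuous_integrable_I => t; apply: cvgM; last exact: cX_cont.
  by apply: cvgM; exact: s_cont.
- apply: continuous_integrable_I => t; apply: cvgM; last exact: cX_cont.
  by apply: cvgM; exact: ac_cont.
Qed.

Let quarter : D / 4 \in I.
Proof. by rewrite in_itv/=; have := D0 => D_gt0; apply/andP; split; lra. Qed.

Let s_quarter : s (D / 4) != 0.
Proof.
rewrite lt0r_neq0// /s mulrA aD; apply: sin_gt0_pi; have := pi_gt0 R.
by move=> pi0; apply/andP; split; lra.
Qed.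

Let cd : c d = 0. Proof. by rewrite /c ad cos_pihalf. Qed.

Let cNd : c (- d) = 0. Proof. by rewrite /c mulrN cosN. Qed.

Let sin_mean0 : \int[mu]_(t in [set` I]) (s t * w t) = 0.
Proof.
pose F t := - (c t ^+ n.+1 / (n.+1%:R * a)).
have dF (t : R) : is_derive t (1 : R) F (s t * w t).
  have := is_deriveN (is_deriveM_real (is_deriveX_real n.+1 (dc t))
    (is_derive_cst (n.+1%:R * a)^-1 t (1:R))).
  move/is_derive_eq; apply; rewrite /cst mulr0 addr0 /= /w.
  by field; rewrite lt0r_neq0//= lt0r_neq0// ltr_pwDr.
have fc : continuous (fun t => s t * w t).
  by move=> t; apply: cvgM; [exact: s_cont|exact: cX_cont].
by rewrite (Rintegral_I dF fc) /F cd cNd subrr.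
Qed.

Let sin_rayleigh :
  \int[mu]_(t in [set` I]) ((a * c t) ^+ 2 * w t)
  = n.+1%:R * a ^+ 2 * \int[mu]_(t in [set` I]) (s t ^+ 2 * w t).
Proof.
pose f t := (a * c t) ^+ 2 * w t - n.+1%:R * a ^+ 2 * (s t ^+ 2 * w t).
have [_ i1 i2] := sin_H1.
have i3 := @integrableZl _ _ _ mu _ mI (n.+1%:R * a ^+ 2) _ i1.
apply/eqP; rewrite -subr_eq0 -(RintegralZl _ mI i1) -(RintegralB mI i2 i3) -/f.
(* The difference of the two integrands is the derivative of [a s c^(n+1)], which vanishes at both
   ends. *)
pose F t := a * (s t * c t ^+ n.+1).
have dF (t : R) : is_derive t (1 : R) F (f t).
  have := is_deriveM_real (is_derive_cst a t (1:R))
    (is_deriveM_real (ds t) (is_deriveX_real n.+1 (dc t))).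
  move/is_derive_eq; apply; rewrite /cst mul0r add0r /= /f /w [c t ^+ n.+1]exprS.
  by ring.
have fc : continuous f.
  move=> t; apply: cvgB.
    apply: cvgM; last exact: cX_cont.
    by apply: cvgM; exact: ac_cont.
  apply: cvgM; first exact: cvg_cst.
  apply: cvgM; last exact: cX_cont.
  by apply: cvgM; exact: s_cont.
by rewrite (Rintegral_I dF fc) /F cd cNd expr0n/= !mulr0 subrr.
Qed.

(** The sine is admissible and realizes the value, while the weighted Poincare inequality bounds
    every other quotient from below. *)
Lemma ereal_inf_rayleigh :
  ereal_inf (EFin @` rayleigh_values D w) = (n.+1%:R * a ^+ 2)%:E.
Proof.
apply/eqP; rewrite eq_le; apply/andP; split.
  apply: ereal_inf_lbound; exists (n.+1%:R * a ^+ 2) => //.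
  exists s, (fun t => a * c t); split => //.
    by exists (D / 4).
  have [p1 p2 p3] := sin_H1.
  have p4 : forall u v : R, - d < u -> u <= v -> v < d ->
      mu.-integrable `[u, v] (EFin \o (fun t => a * c t)) /\
      s v - s u = \int[mu]_(t in `[u, v]) (a * c t) := p1.
  have := integral_sqr_weight_gt0 a0 ad p4 quarter s_quarter p2.
  by move=> /lt0r_neq0 y0; rewrite /rayleigh_quotient sin_rayleigh mulfK.
apply: le_ereal_inf_tmp => _ [q [phi [dphi [[p1 p2 p3] [t tI phit] mean0 ->]]] <-].
have y0 := integral_sqr_weight_gt0 a0 ad p1 tI phit p2.
rewrite lee_fin /rayleigh_quotient ler_pdivlMr//.
exact: weighted_poincare ad p1 p3 p2 mean0.
Qed.

End rayleigh.

(** * The eigenvalue [mu1] of the model problem and its comparison *)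

Section model.
Context {R : realType} (m : nat).

Lemma ck0 (t : R) : ck 0 t = 1.
Proof. by rewrite /ck ltxx eqxx. Qed.

Lemma Tk0 (t : R) : Tk 0 t = 0.
Proof. by rewrite /Tk ltxx eqxx. Qed.

Lemma ck_gt0 (k t : R) : 0 < k -> ck k t = cos (Num.sqrt k * t).
Proof. by rewrite /ck => ->. Qed.

Lemma Tk_gt0 (k t : R) : 0 < k ->
  Tk k t = Num.sqrt k * tan (Num.sqrt k * t).
Proof. by rewrite /Tk => ->. Qed.

Lemma mu1_singular (n : nat) (a k1 k2 D : R) : 0 < a -> a * D = pi ->
  singular_endpoints k1 k2 D ->
  model_weight m k1 k2 = (fun t => cos (a * t) ^+ n) ->
  mu1 m k1 k2 D = (n.+1%:R * a ^+ 2)%:E.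
Proof.
move=> a0 aD sing wE; rewrite /mu1; case: asboolP => // _.
by rewrite wE; exact: ereal_inf_rayleigh.
Qed.

Lemma neumann_eigenvalue_ge (n : nat) (a k1 k2 D lam : R) :
  0 < a -> 0 < D -> a * D < pi ->
  (forall t, model_coef m k1 k2 t = n%:R * (a * tan (a * t))) ->
  lam != 0 -> neumann_eigenvalue m k1 k2 D lam -> n.+1%:R * a ^+ 2 <= lam.
Proof.
move=> a0 D0 aD coefE lam0 [phi [phi0 ode dl dr]].
apply: (@neumann_gap _ n a (D / 2) lam phi) => //.
- by rewrite divr_gt0.
- by rewrite mulrA ltr_pM2r// invr_gt0.
- by move=> t /ode; rewrite coefE.
Qed.

Lemma mu1_regular_ge (n : nat) (a k1 k2 D : R) :
  0 < a -> 0 < D -> a * D < pi -> ~ singular_endpoints k1 k2 D ->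
  (forall t, model_coef m k1 k2 t = n%:R * (a * tan (a * t))) ->
  ((n.+1%:R * a ^+ 2)%:E <= mu1 m k1 k2 D)%E.
Proof.
move=> a0 D0 aD reg coefE; rewrite /mu1; case: asboolP => // _.
apply: le_ereal_inf_tmp => _ [lam [lam0 ev] <-].
by rewrite lee_fin; exact: neumann_eigenvalue_ge ev.
Qed.

Lemma mu1_flat (D : R) : 0 < D -> mu1 m 0 0 D = (pi ^+ 2 / D ^+ 2)%:E.
Proof.
move=> D0; rewrite /mu1 asboolF; last first.
  by apply; rewrite /Tk_finite mulr0 ck0 oner_neq0.
have coef0 (t : R) : model_coef m 0 0 t = 0.
  by rewrite /model_coef mulr0 Tk0 mulr0 addr0.
have pi0 := pi_gt0 R; pose b : R := pi / D.
have b0 : 0 < b by rewrite divr_gt0.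
have bD : b * D = pi by rewrite divfK// lt0r_neq0.
rewrite -expr_div_n -/b; apply/eqP; rewrite eq_le; apply/andP; split.
(* The eigenfunction is [sin (b t)]: its derivative [b cos (b t)] vanishes at both ends because
   [b * (D / 2) = pi / 2]. *)
- apply: ereal_inf_lbound; exists (b ^+ 2) => //; split.
    by rewrite expf_neq0// lt0r_neq0.
  have d1 : derive1 (fun t => sin (b * t)) = (fun t => b * cos (b * t)).
    by apply/funext => t; rewrite derive1E; case: (is_derive_sinM b t).
  have d2 (t : R) : is_derive t 1 (fun t => b * cos (b * t)) (- b ^+ 2 * sin (b * t)).
    have := is_deriveM_real (is_derive_cst b t (1 : R)) (is_derive_cosM b t).
    by move/is_derive_eq; apply; rewrite /cst; ring.
  have lim0 (x : R) : cos (b * x) = 0 ->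
      b * cos (b * t) @[t --> x] --> (0 : R).
    by move=> cx; have := is_derive_cvg (d2 x); rewrite cx mulr0.
  have bd : b * (D / 2) = pi / 2 by rewrite mulrA bD.
  exists (fun t => sin (b * t)); split.
  + exists (D / 4); first by rewrite in_itv/=; apply/andP; split; lra.
    rewrite lt0r_neq0// mulrA bD; apply: sin_gt0_pi; apply/andP; split; lra.
  + move=> t _; split; first by case: (is_derive_sinM b t).
      by rewrite d1; case: (d2 t).
    rewrite coef0 mul0r subr0 /= d1 derive1E.
    by case: (d2 t) => _ ->.
  + rewrite d1; apply/cvg_at_right_filter/lim0.
    by rewrite mulrN cosN bd cos_pihalf.
  + by rewrite d1; apply/cvg_at_left_filter/lim0; rewrite bd cos_pihalf.
- apply: le_ereal_inf_tmp => _ [lam [lam0 ev] <-]; rewrite lee_fin leNgt.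
  (* The zero coefficient is the case [n = 0] of the gap estimate for any [a] with [a * D < pi]. The
     midpoint of [Num.sqrt lam] and [b] is such an [a] and satisfies [lam < a ^+ 2], a
     contradiction; for negative [lam] the square root is 0 by convention. *)
  apply/negP => lamb; pose a := (Num.sqrt lam + b) / 2.
  have sb : Num.sqrt lam < b.
    by rewrite -(ger0_norm (ltW b0)) -sqrtr_sqr ltr_sqrt// exprn_gt0.
  have s0 := sqrtr_ge0 lam.
  have a0 : 0 < a by rewrite /a; lra.
  have aD : a * D < pi by rewrite -bD ltr_pM2r// /a; lra.
  have := @neumann_eigenvalue_ge 0 a 0 0 D lam a0 D0 aD _ lam0 ev.
  rewrite mul1r => /(_ _)/wrap[|]; first by move=> t; rewrite coef0 mul0r.
  apply/negP; rewrite -ltNge.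
  have sa : Num.sqrt lam < a by rewrite /a; lra.
  have [l0|l0] := leP 0 lam; last exact: lt_trans l0 (exprn_gt0 _ a0).
  by rewrite -[X in X < _](sqr_sqrtr l0) ltr_pXn2r// ?nnegrE// ltW.
Qed.

(** Otherwise the zero [pi / (2 a)] of the cosine would lie inside the interval. *)
Lemma mulr_le_pi_of_cosM_neq0 (a D : R) : 0 < a ->
  (forall t, t \in `](- (D / 2)), (D / 2)[ -> cos (a * t) != 0) -> a * D <= pi.
Proof.
move=> a0 c0; rewrite leNgt; apply/negP => aD.
have pi0 := pi_gt0 R.
have : pi / a < D by rewrite ltr_pdivrMr// mulrC.
have : 0 < pi / a by rewrite divr_gt0.
move=> h1 h2; have := c0 (pi / a / 2).
rewrite in_itv/= => /(_ _)/wrap[|]; first by apply/andP; split; lra.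
have -> : a * (pi / a / 2) = pi / 2 by field; exact: lt0r_neq0.
by rewrite cos_pihalf eqxx.
Qed.

(** Finiteness of the coefficient gives [a * D <= pi]. In the case of equality [D] is the singular
    length [pi / a] itself; otherwise the endpoints are regular and the gap estimate gives the same
    constant as a lower bound. *)
Lemma mu1_comparison (n : nat) (a k1 k2 D : R) : 0 < a -> 0 < D ->
  (forall t, ~ (Tk_finite k2 t /\ Tk_finite (4 * k1) t) <-> cos (a * t) = 0) ->
  (forall t, model_coef m k1 k2 t = n%:R * (a * tan (a * t))) ->
  model_weight m k1 k2 = (fun t => cos (a * t) ^+ n) ->
  model_considered k1 k2 D ->
  (mu1 m k1 k2 (pi / a) <= mu1 m k1 k2 D)%E /\
  mu1 m k1 k2 (pi / a) = (n.+1%:R * a ^+ 2)%:E.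
Proof.
move=> a0 D0 finE coefE wE model.
have aD : a * D <= pi.
  apply: mulr_le_pi_of_cosM_neq0 => // t /model fin; apply/eqP => /finE; exact.
have aD0 : a * (pi / a) = pi by rewrite mulrC divfK// lt0r_neq0.
have E : mu1 m k1 k2 (pi / a) = (n.+1%:R * a ^+ 2)%:E.
  apply: mu1_singular => //; apply/finE.
  by rewrite mulrA aD0 cos_pihalf.
split => //; move: aD; rewrite le_eqVlt => /predU1P[aD|aD].
  by rewrite -aD mulrAC divff ?mul1r// lt0r_neq0.
rewrite E; apply: mu1_regular_ge => // /finE.
apply/eqP; rewrite lt0r_neq0//; apply: cos_gt0_pihalf.
have := mulr_gt0 a0 D0; have := pi_gt0 R; rewrite mulrA => ? ?.
by apply/andP; split; lra.
Qed.

End model.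

(** * Choice of [a] and [n] in the three curvature cases *)

Unset Implicit Arguments.

Theorem proposition1p1 (R : realType) (m : nat) (hm : (0 < m)%N)
    (M : topologicalType) (K : kahler_manifold R m M)
    (M_nonempty : [set: M] !=set0)
    (M_compact : compact [set: M]) (M_connected : connected [set: M])
    (M_boundary : manifold_boundary K = set0 \/ strictly_convex_boundary K)
    (D : R) (D_diameter : diameter K = D%:E) (D_gt0 : 0 < D)
    (kappa1 kappa2 : R)
    (H_ge : hol_sect_curv_ge K (4 * kappa1))
    (Ric_ge : orth_ricci_ge K (2 * (m%:R - 1) * kappa2))
    (model : model_considered kappa1 kappa2 D) :
  [/\ kappa1 = 0 -> kappa2 = 0 ->
        mu1 m kappa1 kappa2 D = (pi ^+ 2 / D ^+ 2)%:E,
      0 < kappa1 -> kappa2 = 0 ->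
        (mu1 m kappa1 0 (pi / (2 * Num.sqrt kappa1)) <= mu1 m kappa1 kappa2 D)%E
        /\ mu1 m kappa1 0 (pi / (2 * Num.sqrt kappa1)) = (8 * kappa1)%:E &
      kappa1 = 0 -> 0 < kappa2 ->
        (mu1 m 0 kappa2 (pi / Num.sqrt kappa2) <= mu1 m kappa1 kappa2 D)%E
        /\ mu1 m 0 kappa2 (pi / Num.sqrt kappa2)
           = ((2 * m%:R - 1) * kappa2)%:E].
Proof.
split.
- by move=> -> ->; exact: mu1_flat.
- move=> k1 k2; subst kappa2.
  (* Here [a = 2 * Num.sqrt kappa1] and [n = 1], so that [(n + 1) a^2 = 8 kappa1]. *)
  have k4 : 0 < 4 * kappa1 by rewrite mulr_gt0.
  have sq4 : Num.sqrt (4 * kappa1) = 2 * Num.sqrt kappa1.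
    rewrite sqrtrM// (_ : 4 = 2 ^+ 2) ?sqrtr_sqr ?ger0_norm//.
    by rewrite -natrX.
  have -> : 8 * kappa1 = 2%:R * (2 * Num.sqrt kappa1) ^+ 2.
    by rewrite exprMn sqr_sqrtr ?ltW//; ring.
  apply: (@mu1_comparison _ _ 1) => //.
  + by rewrite mulr_gt0// sqrtr_gt0.
  + move=> t; rewrite /Tk_finite ck0 ck_gt0// sq4; split.
      by move=> h; apply/eqP/negPn/negP => h'; apply: h; rewrite oner_neq0.
    by move=> -> [_]; rewrite eqxx.
  + by move=> t; rewrite /model_coef Tk0 Tk_gt0// sq4 mulr0 add0r mul1r.
  + by apply/funext => t; rewrite /model_weight ck0 expr1n mul1r ck_gt0// sq4.
- move=> k1 k2; subst kappa1.
  (* Here [a = Num.sqrt kappa2] and [n = 2 * m - 2]; the truncated subtraction agrees with the real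
     one because [0 < m]. *)
  have m2 : (2 * m - 2)%:R = 2 * (m%:R - 1) :> R.
    by rewrite natrB ?natrM; [ring|rewrite leq_pmulr].
  have -> : (2 * m%:R - 1) * kappa2 = (2 * m - 2).+1%:R * Num.sqrt kappa2 ^+ 2.
    by rewrite sqr_sqrtr ?ltW// -[(2 * m - 2).+1%:R]natr1 m2; ring.
  apply: mu1_comparison => //.
  + by rewrite sqrtr_gt0.
  + move=> t; rewrite /Tk_finite mulr0 ck0 ck_gt0//; split.
      by move=> h; apply/eqP/negPn/negP => h'; apply: h; rewrite oner_neq0.
    by move=> -> []; rewrite eqxx.
  + by move=> t; rewrite /model_coef mulr0 Tk0 Tk_gt0// addr0 m2.
  + by apply/funext => t; rewrite /model_weight mulr0 ck0 mulr1 ck_gt0.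
Qed.
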